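(* With $$a=c=h=r=q,\qquad b=f=d=\ell=t=q^2,\qquad g=w=0,\qquad p=u=1,\qquad s=2q,$$ one has $$\mathcal C(z)=\sum_{n\ge0}\sum_{\pi\in\mathcal S_n}q^{\mathsf{inv}(\pi)}z^n .$$ If, in addition, $z$ is replaced by $z((k-1)q+1)$, then $\mathcal C$ gives the distribution of inversions over the $k$-colored permutations for $k>1$: with the same parameter values, $$\mathcal C\bigl(z((k-1)q+1)\bigr)=\sum_{n\ge0}\sum_{P\in\mathcal S_n^k}q^{\mathsf{inv}(P)}z^n .$$
   Context: $\mathcal S_n$ is the set of permutations of $[n]=\{1,\dots,n\}$; for $\pi\in\mathcal S_n$, $\mathsf{inv}(\pi)$ is the number of pairs $i<j$ in $[n]$ with $\pi(i)>\pi(j)$. A $k$-colored permutation of $[n]$ is a pair $P=(a_1\ldots a_n,\ c_1\ldots c_n)$ where $a_1\ldots a_n$ is a permutation of $[n]$ and each $c_i\in\{0,1,\dots,k-1\}$; the set of these is $\mathcal S_n^k$. One declares $a_{n+1}=n+1$ and $c_{n+1}=0$, and orders pairs by $(a_i,c_i)>(a_j,c_j)$ if $c_i>c_j$, or $c_i=c_j$ and $a_i>a_j$. For $P\in\mathcal S_n^k$, $\mathsf{inv}(P)$ is the number of pairs $(i,j)$ with $1\le i<j\le n+1$ and $(a_i,c_i)>(a_j,c_j)$. For $n\ge1$, $[n]_{x,y}:=\sum_{i=0}^{n-1}x^{n-1-i}y^{i}$, and $[0]_{x,y}:=0$, with the convention $0^0=1$. For parameters $a,b,c,d,f,g,h,\ell,p,r,s,t,u,w$,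 $\mathcal C(z)$ is the formal power series in $z$ defined by the continued fraction $$\mathcal C(z)=\cfrac{1}{1-\alpha_0z-\cfrac{\beta_1z^2}{1-\alpha_1z-\cfrac{\beta_2z^2}{\ddots}}},\qquad \alpha_n=u\,w^n+s\,[n]_{a,b}+t\,[n]_{f,g}\ (n\ge 0),\quad \beta_n=p\,r\,[n]_{c,d}\,[n]_{h,\ell}\ (n\ge 1).$$ *)

(* Defs.v *)
From HB Require Import structures.
From mathcomp Require Import all_boot all_order all_algebra all_fingroup.

Set Implicit Arguments.
Unset Strict Implicit.
Unset Printing Implicit Defensive.

Import GRing.Theory.
Local Open Scope ring_scope.

(* A formal power series is its sequence of coefficients, [F n] being the     *)
(* coefficient of z^n; equality of series is pointwise equality [=1].         *)
Definition fps (R : Type) := nat -> R.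

Section FormalPowerSeries.
Variable R : comNzRingType.
Implicit Types F G : fps R.

Definition fps0 : fps R := fun=> 0.
Definition fps1 : fps R := fun n => (n == 0)%:R.
Definition fps_sub F G : fps R := fun n => F n - G n.
Definition fps_mul F G : fps R := fun n => \sum_(i < n.+1) F i * G (n - i)%N.
Definition fps_exp F (m : nat) : fps R := iter m (fps_mul F) fps1.

(* The monomial x z^m. *)
Definition fps_mono (x : R) (m : nat) : fps R := fun n => if n == m then x else 0.

(* The geometric series \sum_m (1 - F)^m. It is the inverse of F when F has   *)
(* constant term 1 (fps_mulV below): (1 - F)^m then starts in degree m, so    *)
(* only the terms m <= n contribute to the coefficient of z^n.                *)
Definition fps_inv F : fps R :=
  fun n => \sum_(m < n.+1) fps_exp (fps_sub fps1 F) m n.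

(* F(x z) = \sum_n F_n (x z)^n. *)
Definition fps_subst_scale (x : R) F : fps R := fun n => F n * x ^+ n.

Lemma fps_exp_low F m n : F 0 = 0 -> (n < m)%N -> fps_exp F m n = 0.
Proof.
move=> F0; elim: m n => // m IHm n ltnm.
rewrite /fps_exp iterS -/(fps_exp F m) /fps_mul big1 // => -[[|i] /= lti] _.
  by rewrite F0 mul0r.
rewrite IHm ?mulr0 //; case: n ltnm lti => [|n] //; rewrite !ltnS => ltnm lei.
by rewrite subSS (leq_ltn_trans (leq_subr _ _)).
Qed.

Lemma fps_invE F N n : F 0 = 1 -> (n <= N)%N ->
  fps_inv F n = \sum_(m < N.+1) fps_exp (fps_sub fps1 F) m n.
Proof.
move=> F0 lenN.
have H0 : fps_sub fps1 F 0 = 0 by rewrite /fps_sub F0 subrr.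
rewrite /fps_inv -!(big_mkord xpredT (fun m => fps_exp (fps_sub fps1 F) m n)).
rewrite [RHS](@big_cat_nat _ _ _ n.+1) //= [X in _ + X]big_nat_cond.
by rewrite [X in _ + X]big1 ?addr0 // => m /andP[/andP[ltnm _] _]; apply: fps_exp_low.
Qed.

Lemma fps_mulV F : F 0 = 1 -> fps_mul F (fps_inv F) =1 fps1.
Proof.
move=> F0 n; set H := fps_sub fps1 F.
have H0 : H 0 = 0 by rewrite /H /fps_sub F0 subrr.
have -> : fps_mul F (fps_inv F) n = \sum_(m < n.+1) fps_mul F (fps_exp H m) n.
  rewrite /fps_mul exchange_big /=; apply: eq_bigr => i _.
  by rewrite -mulr_sumr -(@fps_invE F n) ?leq_subr.
have step m : fps_mul F (fps_exp H m) n = - (fps_exp H m.+1 n - fps_exp H m n).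
  have -> : fps_exp H m n = fps_mul fps1 (fps_exp H m) n.
    rewrite /fps_mul big_ord_recl subn0 mul1r big1 ?addr0 // => i _.
    by rewrite /fps1 mul0r.
  rewrite /fps_exp iterS -/(fps_exp H m) /fps_mul -sumrB -sumrN.
  by apply: eq_bigr => i _; rewrite -mulrBl /H /fps_sub -mulNr opprB opprB addrCA subrr addr0.
under eq_bigr => m _ do rewrite step.
rewrite sumrN -(big_mkord xpredT (fun m => fps_exp H m.+1 n - fps_exp H m n)).
by rewrite telescope_sumr // fps_exp_low // sub0r opprK.
Qed.

End FormalPowerSeries.

Section JFraction.
Variables (R : comNzRingType) (alpha beta : nat -> R).

(* The continued fraction read from level m on,                               *)
(*   1/(1 - alpha_m z - beta_{m+1} z^2/(1 - alpha_{m+1} z - ...)),            *)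
(* cut after N levels.                                                        *)
Fixpoint jfrac_conv (m N : nat) : fps R :=
  if N is N'.+1 then
    fps_inv (fps_sub (fps_sub (@fps1 R) (fps_mono (alpha m) 1))
                     (fps_mul (fps_mono (beta m.+1) 2) (jfrac_conv m.+1 N')))
  else @fps0 R.

(* Each denominator of a convergent has constant term 1, so [fps_inv] is its  *)
(* inverse.                                                                   *)
Lemma jfrac_denom0 m (F : fps R) :
  fps_sub (fps_sub (@fps1 R) (fps_mono (alpha m) 1))
          (fps_mul (fps_mono (beta m.+1) 2) F) 0 = 1.
Proof.
by rewrite /fps_sub /fps_mul big_ord1 /fps1 /fps_mono /= mul0r !subr0.
Qed.

(* The infinite continued fraction is the coefficientwise limit of its        *)
(* convergents: by jfrac_stable the coefficient of z^n is constant from the   *)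
(* convergent of depth n + 1 on.                                              *)
Definition jfrac : fps R := fun n => jfrac_conv 0 n.+1 n.

End JFraction.

Lemma eq_fps_inv (R : comNzRingType) (F G : fps R) n :
  (forall i, (i <= n)%N -> F i = G i) -> fps_inv F n = fps_inv G n.
Proof.
move=> eqFG; apply: eq_bigr => -[m _] _ /=.
elim: m n eqFG => // m IHm n eqFG; rewrite /fps_exp !iterS.
apply: eq_bigr => -[i /=]; rewrite ltnS => lein _.
congr (_ * _); first by rewrite /fps_sub eqFG.
by apply: IHm => j lej; apply/eqFG/(leq_trans lej)/leq_subr.
Qed.

Lemma jfrac_conv_stable (R : comNzRingType) (alpha beta : nat -> R) m N M n :
  (n < N)%N -> (n < M)%N ->
  jfrac_conv alpha beta m N n = jfrac_conv alpha beta m M n.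
Proof.
elim: N M m n => // N IHN [|M] // m n; rewrite !ltnS => leN leM /=.
apply: eq_fps_inv => i lein; congr (_ - _); apply: eq_bigr => -[[|j] /= ltj] _.
  by rewrite /fps_mono !mul0r.
case: i lein ltj => [|i] // lein _; congr (_ * _).
by rewrite subSS; apply: IHN; apply: leq_trans (leq_trans _ lein) _ => //;
   rewrite ltnS leq_subr.
Qed.

Lemma jfrac_stable (R : comNzRingType) (alpha beta : nat -> R) N n :
  (n < N)%N -> jfrac_conv alpha beta 0 N n = jfrac alpha beta n.
Proof. by move=> ltnN; apply: jfrac_conv_stable. Qed.

(* [n]_{x,y}; the empty sum gives [0]_{x,y} = 0, and 0 ^+ 0 = 1. *)
Definition xynum (R : comNzRingType) (n : nat) (x y : R) : R :=
  \sum_(i < n) x ^+ (n.-1 - i) * y ^+ i.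

Record cf_param (R : Type) := CFParam {
  par_a : R; par_b : R; par_c : R; par_d : R; par_f : R; par_g : R; par_h : R;
  par_l : R; par_p : R; par_r : R; par_s : R; par_t : R; par_u : R; par_w : R
}.

Section ContinuedFraction.
Variables (R : comNzRingType) (v : cf_param R).

Definition cf_alpha (n : nat) : R :=
  par_u v * par_w v ^+ n + par_s v * xynum n (par_a v) (par_b v)
    + par_t v * xynum n (par_f v) (par_g v).

Definition cf_beta (n : nat) : R :=
  par_p v * par_r v * xynum n (par_c v) (par_d v) * xynum n (par_h v) (par_l v).

Definition cfC : fps R := jfrac cf_alpha cf_beta.

End ContinuedFraction.

(* Positions and letters are numbered from 0 instead of 1. *)
Definition inversions (n : nat) (pi : 'S_n) : nat :=
  #|[set ij : 'I_n * 'I_n | (ij.1 < ij.2)%N && (pi ij.2 < pi ij.1)%N]|.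

(* P.1 is the word a_1 ... a_n and P.2 the word of colors c_1 ... c_n. *)
Notation colored_perm n k := ('S_n * {ffun 'I_n -> 'I_k})%type.

Section ColoredInversions.
Variables (n k : nat) (P : colored_perm n k).

(* The words extended by a_{n+1} = n+1 (that is, n when letters start at 0)   *)
(* and c_{n+1} = 0 in the last position [ord_max].                            *)
Definition ext_letter (i : 'I_n.+1) : nat :=
  if unlift ord_max i is Some j then P.1 j else n.

Definition ext_color (i : 'I_n.+1) : nat :=
  if unlift ord_max i is Some j then P.2 j else 0%N.

Definition colored_gt (i j : 'I_n.+1) : bool :=
  (ext_color j < ext_color i)%N
  || (ext_color i == ext_color j) && (ext_letter j < ext_letter i)%N.

Definition colored_inversions : nat :=
  #|[set ij : 'I_n.+1 * 'I_n.+1 | (ij.1 < ij.2)%N && colored_gt ij.1 ij.2]|.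

End ColoredInversions.

(* Main.v *)
Require Import Defs.
From HB Require Import structures.
From mathcomp Require Import all_boot all_order all_algebra all_fingroup.
From mathcomp Require Import ring zify.
Import GRing.Theory.
Local Open Scope ring_scope.

(** Here alpha_n = q^n ([n]_q + [n+1]_q) and beta_n = q^(2n-1) [n]_q^2. If F_m is
    the continued fraction read from level m on, the coefficients a_(n,k) of
    z^k F_0 F_1 ... F_k satisfy the Stieltjes recurrence
      a_(n+1,k) = a_(n,k-1) + alpha_k a_(n,k) + beta_(k+1) a_(n,k+1),
    which together with a_(0,k) = [k = 0] determines them. It is solved by
    a_(n,k) = qbinomial(n,k)^2 [n-k]_q!, so that C(z) = \sum_n [n]_q! z^n, and
    [n]_q! is the distribution of inversions over S_n.

    For colored permutations, attach the colors to the letters instead of the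
    positions. For a fixed coloring the letters are just n elements in some total
    order, which contributes [n]_q!, and the last position contributes a factor q
    for each nonzero color, hence the factor ((k-1) q + 1)^n. *)

(** * Continued fractions and the Stieltjes recurrence *)

Section Stieltjes.
Variable R : comNzRingType.
Implicit Types F G H : fps R.

(** Truncating to [{poly R}] lets the Cauchy product inherit associativity and commutativity from
    polynomials. *)
Lemma fps_mul_coef F G n N : (n < N)%N ->
  fps_mul F G n = ((\poly_(i < N) F i) * (\poly_(i < N) G i))`_n.
Proof.
move=> ltnN; rewrite coefM; apply: eq_bigr => -[i /= lein] _.
by rewrite !coef_poly (leq_ltn_trans _ ltnN) // (leq_ltn_trans (leq_subr _ _)).
Qed.

Lemma fps_mulA F G H : fps_mul F (fps_mul G H) =1 fps_mul (fps_mul F G) H.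
Proof.
move=> n; pose t E : {poly R} := \poly_(i < n.+1) E i.
transitivity ((t F * (t G * t H))`_n).
  rewrite coefM; apply: eq_bigr => -[i lein] _ /=.
  by rewrite coef_poly lein (@fps_mul_coef G H _ n.+1) // ltnS leq_subr.
rewrite mulrA coefM; apply: eq_bigr => -[i lein] _ /=.
by rewrite (@coef_poly _ n.+1) ltnS leq_subr (@fps_mul_coef F G _ n.+1).
Qed.

Lemma fps_mulC F G : fps_mul F G =1 fps_mul G F.
Proof. by move=> n; rewrite !(@fps_mul_coef _ _ n n.+1) // mulrC. Qed.

Definition fps_shift F : fps R := fun n => if n is n'.+1 then F n' else 0.

Lemma eq_fps_shift F G : F =1 G -> fps_shift F =1 fps_shift G.
Proof. by move=> eFG []. Qed.

Lemma fps_shift_mull F G : fps_mul (fps_shift F) G =1 fps_shift (fps_mul F G).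
Proof.
case=> [|n]; first by rewrite /fps_mul big_ord1 mul0r.
by rewrite /fps_mul big_ord_recl mul0r add0r.
Qed.

Lemma fps_shift_mulr F G : fps_mul F (fps_shift G) =1 fps_shift (fps_mul F G).
Proof.
move=> n; rewrite fps_mulC fps_shift_mull.
exact/eq_fps_shift/fps_mulC.
Qed.

Lemma eq_fps_mul F F' G G' :
  F =1 F' -> G =1 G' -> fps_mul F G =1 fps_mul F' G'.
Proof. by move=> eF eG n; apply: eq_bigr => i _; rewrite eF eG. Qed.

Lemma fps_mulS F G n :
  fps_mul F G n.+1 = F 0 * G n.+1 + \sum_(i < n.+1) F i.+1 * G (n - i)%N.
Proof. by rewrite /fps_mul big_ord_recl subn0. Qed.

Lemma fps_mulSr F G n :
  fps_mul F G n.+1 =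
  \sum_(i < n.+1) F i * G (n - i).+1 + F n.+1 * G 0.
Proof.
rewrite /fps_mul big_ord_recr /= subnn; congr (_ + _).
by apply: eq_bigr => -[i lein] _ /=; rewrite subSn.
Qed.

Variables (alpha beta : nat -> R).

Definition jfrac_from (m : nat) : fps R :=
  fun n => jfrac_conv alpha beta m n.+1 n.

Let F := jfrac_from.

Lemma jfrac_fromE m N n : (n < N)%N -> jfrac_conv alpha beta m N n = F m n.
Proof. by move=> ltnN; apply: jfrac_conv_stable. Qed.

Lemma jfrac_from_eq m n :
  fps_mul (fps_sub (fps_sub (@fps1 R) (fps_mono (alpha m) 1))
             (fps_mul (fps_mono (beta m.+1) 2) (F m.+1))) (F m) n = fps1 R n.
Proof.
(* The convergent of depth n+2 satisfies its own equation exactly, and all coefficients involved up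
   to degree n have already stabilized. *)
rewrite -(fps_mulV
  (jfrac_denom0 alpha beta m (jfrac_conv alpha beta m.+1 n.+1))).
apply: eq_bigr => -[i lein] _ /=; congr (_ * _).
  congr (_ - _); apply: eq_bigr => -[j leji] _ /=; congr (_ * _).
  by rewrite -(@jfrac_fromE _ n.+1) // (leq_ltn_trans (leq_subr _ _)).
rewrite -(@jfrac_fromE _ n.+2) //.
by rewrite ltnS (leq_trans (leq_subr _ _)).
Qed.

Lemma jfrac_from0 m : F m 0 = 1.
Proof.
by have := jfrac_from_eq m 0; rewrite /fps_mul big_ord1 jfrac_denom0 mul1r.
Qed.

Lemma fps_mul_mono2 x G n : fps_mul (fps_mono x 2) G n.+2 = x * G n.
Proof.
rewrite !fps_mulS [fps_mono x 2 0%N]/fps_mono mul0r add0r.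
rewrite !big_ord_recl big1 => [|i _]; last by rewrite /fps_mono /= mul0r.
by rewrite /fps_mono /= mul0r add0r addr0 subSS subn0.
Qed.

(** This is F_m = 1 + alpha_m z F_m + beta_(m+1) z^2 F_(m+1) F_m, read in degree n+1. *)
Lemma jfrac_fromS m n :
  F m n.+1 = alpha m * F m n
    + beta m.+1 * fps_shift (fps_mul (F m.+1) (F m)) n.
Proof.
have := jfrac_from_eq m n.+1; rewrite fps_mulS jfrac_denom0 mul1r.
rewrite big_ord_recl subn0 {1}/fps_sub {1}/fps_sub.
rewrite fps_mulS big_ord1 /fps1 /fps_mono /=.
rewrite !(mul0r, add0r, sub0r) subr0.
case: n => [|n] /=.
  by rewrite big_ord0 addr0 mulr0 addr0 mulNr => /eqP; rewrite subr_eq0 => /eqP.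
under eq_bigr => i _.
  have -> : bump 0 i = i.+1 by [].
  rewrite [fps_sub _ _ _]/fps_sub fps_mul_mono2 /fps_sub /= !sub0r oppr0 add0r.
  rewrite subSS mulNr -mulrA; over.
rewrite sumrN -mulr_sumr mulNr => /eqP.
by rewrite -opprD subr_eq0 => /eqP.
Qed.

(* z^k F_0 F_1 ... F_k, whose coefficients count weighted Motzkin paths from
   height 0 to height k. *)
Fixpoint jfrac_column (k : nat) : fps R :=
  if k is k'.+1 then fps_shift (fps_mul (jfrac_column k') (F k))
  else F 0.
Let A := jfrac_column.

(** Expand the last factor F_k by its functional equation: the term 1 drops the factor, the alpha
    term keeps the column, and the beta term appends F_(k+1). *)
Lemma jfrac_column_rec k n :
  A k n.+1 = (if k is k'.+1 then A k' n else 0)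
    + alpha k * A k n + beta k.+1 * A k.+1 n.
Proof.
case: k => [|k].
  rewrite /= jfrac_fromS add0r; congr (_ + _ * _).
  exact/eq_fps_shift/fps_mulC.
rewrite -[A k.+1 n.+1]/(fps_mul (A k) (F k.+1) n).
case: n => [|n]; first by rewrite /fps_mul big_ord1 jfrac_from0 /=; ring.
rewrite fps_mulSr jfrac_from0 mulr1 addrC -addrA; congr (_ + _).
have -> : A k.+2 n.+1 =
    fps_mul (A k) (fps_shift (fps_mul (F k.+2) (F k.+1))) n.
  rewrite -[LHS]/(fps_mul (fps_shift (fps_mul (A k) (F k.+1))) (F k.+2) n).
  rewrite fps_shift_mull fps_shift_mulr; apply: eq_fps_shift => j.
  by rewrite -fps_mulA; apply: eq_fps_mul => // i; apply: fps_mulC.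
rewrite -[A k.+1 n.+1]/(fps_mul (A k) (F k.+1) n) /fps_mul !mulr_sumr -big_split.
by apply: eq_bigr => i _ /=; rewrite jfrac_fromS; ring.
Qed.

Lemma jfrac_column0 k : A k 0 = (k == 0%N)%:R.
Proof. by case: k => [|k]; first exact: jfrac_from0. Qed.

Lemma jfrac_stieltjes (a : nat -> nat -> R) :
    (forall k, a 0%N k = (k == 0%N)%:R) ->
    (forall n k, a n.+1 k = (if k is k'.+1 then a n k' else 0)
       + alpha k * a n k + beta k.+1 * a n k.+1) ->
  forall n, jfrac alpha beta n = a n 0%N.
Proof.
move=> a0 aS n; rewrite -[LHS]/(A 0 n).
(* The column index is generalized because each row depends on the neighbouring columns of the
   previous one. *)
elim: n 0%N => [|n IHn] k; first by rewrite jfrac_column0 a0.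
by rewrite jfrac_column_rec aS !IHn; case: k => [|k]; rewrite ?IHn.
Qed.

End Stieltjes.

(** * q-analogs and the explicit solution of the recurrence *)

Section QAnalogs.
Variables (R : comNzRingType) (q : R).

Definition qint (n : nat) : R := \sum_(i < n) q ^+ i.
Definition qfact (n : nat) : R := \prod_(i < n) qint i.+1.
Fixpoint qbin (n k : nat) : R :=
  match n, k with
  | _, 0 => 1
  | 0, _.+1 => 0
  | n'.+1, k'.+1 => qbin n' k' + q ^+ k * qbin n' k
  end.

Lemma qint0 : qint 0 = 0. Proof. exact: big_ord0. Qed.

Lemma qintSr n : qint n.+1 = qint n + q ^+ n.
Proof. exact: big_ord_recr. Qed.

Lemma qintS n : qint n.+1 = 1 + q * qint n.
Proof.
rewrite /qint big_ord_recl mulr_sumr; congr (_ + _).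
by apply: eq_bigr => i _; rewrite exprS.
Qed.

Lemma qfactS n : qfact n.+1 = qfact n * qint n.+1.
Proof. exact: big_ord_recr. Qed.

Lemma qbin0 n : qbin n 0 = 1. Proof. by case: n. Qed.

Lemma qbin_small n k : (n < k)%N -> qbin n k = 0.
Proof.
elim: n k => [|n IHn] [|k] //= ltnk.
by rewrite !IHn ?mulr0 ?addr0 // ltnW.
Qed.

(** A division-free ratio of adjacent q-binomials, as q-integers need not be invertible in [R]. *)
Lemma mul_qint_qbin n k : qint k.+1 * qbin n k.+1 = qint (n - k) * qbin n k.
Proof.
elim: n k => [|n IHn] [|k] /=.
- by rewrite mulr0 qint0 mul0r.
- by rewrite !mulr0.
- have := IHn 0; rewrite subn0 !qbin0 !mulr1 subn0 [qint 1]qintS qint0 => h.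
  by rewrite qintS -h; ring.
rewrite subSS mulrDr mulrCA IHn [RHS]mulrDr -(IHn k).
(* Every term is now a multiple of [qbin n k.+1]. It vanishes for n <= k, where the subtraction
   truncates; otherwise both cofactors equal [n+1]_q. *)
case: (ltnP k n) => [ltkn|lenk]; last by rewrite (@qbin_small n k.+1) //; ring.
rewrite (qintSr k.+1) -(@subnSK k n) // (qintS (n - k.+1)) (exprS q k.+1); ring.
Qed.

(** Termwise, q^(n-1-i) q^(2i) = q^(n-1) q^i. *)
Lemma xynum_qint n : xynum n q (q ^+ 2) = q ^+ n.-1 * qint n.
Proof.
rewrite /qint mulr_sumr; apply: eq_bigr => -[i /= ltin] _.
rewrite -exprM -!exprD; congr (q ^+ _); case: n ltin => // n.
by rewrite ltnS /= => /subnK {2}<-; rewrite mul2n -addnn addnA.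
Qed.

Lemma xynum_x0 n (x : R) : xynum n.+1 x 0 = x ^+ n.
Proof.
rewrite /xynum big_ord_recl subn0 expr0 mulr1 big1 ?addr0 // => i _.
by rewrite exprS mul0r mulr0.
Qed.

(* The coefficient of P_k in x^n, for the monic orthogonal polynomials P_k with
   moments [n]_q!, which are rescaled little q-Laguerre polynomials. *)
Definition laguerre_coef n k : R := qbin n k ^+ 2 * qfact (n - k).

Lemma laguerre_coef_rec n k :
  laguerre_coef n.+1 k = (if k is k'.+1 then laguerre_coef n k' else 0)
    + q ^+ k * (qint k + qint k.+1) * laguerre_coef n k
    + q ^+ k.*2.+1 * qint k.+1 ^+ 2 * laguerre_coef n k.+1.
Proof.
have tail : qint k.+1 ^+ 2 * laguerre_coef n k.+1
    = qint (n - k) * laguerre_coef n k.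
  rewrite /laguerre_coef mulrA -exprMn mul_qint_qbin.
  case: (ltnP k n) => [ltkn|]; last first.
    by rewrite -subn_eq0 => /eqP->; rewrite qint0; ring.
  rewrite -(@subnSK k n) // qfactS; ring.
rewrite -[q ^+ k.*2.+1 * _ * _]mulrA tail.
case: k tail => [|k] _.
  rewrite /laguerre_coef !qbin0 !subn0 qfactS qint0 [qint 1]qintS qint0 qintS.
  by ring.
case: (ltnP k n) => [ltkn|lenk]; last first.
  rewrite [laguerre_coef n k.+1]/laguerre_coef qbin_small //.
  by rewrite /laguerre_coef /= (@qbin_small n k.+1) // subSS; ring.
have e := mul_qint_qbin n k.
rewrite /laguerre_coef /= subSS -(@subnSK k n) // qfactS in e *.
set m := (n - k.+1)%N in e *.
have -> : q ^+ k.+1.*2.+1 = q * (q ^+ k.+1) ^+ 2.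
  by rewrite exprS -muln2 exprM.
rewrite (qintSr k.+1).
(* The squared q-Pascal rule, with the cross term grouped so that [e] applies to
   [qint m.+1 * qbin n k]. *)
transitivity (qfact m * (qint m.+1 * qbin n k ^+ 2
   + 2%:R * q ^+ k.+1 * qbin n k.+1 * (qint m.+1 * qbin n k)
   + (q ^+ k.+1) ^+ 2 * qint m.+1 * qbin n k.+1 ^+ 2)); first by ring.
rewrite -e (qintS m); ring.
Qed.

End QAnalogs.

(** * Inversions of permutations *)

Lemma card_increasing_pairs n (r : rel 'I_n) :
  #|[set ij : 'I_n * 'I_n | (ij.1 < ij.2)%N && r ij.1 ij.2]|
  = (\sum_(i < n) \sum_(j < n) ((i < j)%N && r i j))%N.
Proof.
rewrite pair_big -sum1_card big_mkcond /=.
by apply: eq_bigr => -[i j] _; rewrite inE /=; case: ifP.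
Qed.

Section Permutations.
Variables (R : comNzRingType) (q : R).

Lemma inversionsE n (s : 'S_n) :
  inversions s = (\sum_(i < n) \sum_(j < n) ((i < j) && (s j < s i)))%N.
Proof. exact: (@card_increasing_pairs n (fun i j => s j < s i)%N). Qed.

(** The first letter [j] exceeds exactly [j] later letters, and [lift j] preserves the order of the
    others. *)
Lemma inversions_lift_perm n (j : 'I_n.+1) (s : 'S_n) :
  inversions (lift_perm ord0 j s) = (j + inversions s)%N.
Proof.
have below (i : 'I_n.+1) : (\sum_(k < n) (lift i k < i) = i)%N.
  rewrite -[RHS]card_ord -sum1_card -(big_mkord xpredT (fun=> 1%N)).
  rewrite (big_nat_widen _ _ n) ?leq_ord // [RHS]big_mkcond big_mkord.
  by apply: eq_bigr => k _; rewrite /= /bump; case: (ltnP k i) => [|/leqW]; lia.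
rewrite !inversionsE big_ord_recl; congr (_ + _)%N.
  rewrite big_ord_recl add0n -[RHS](below j) [RHS](reindex_inj (@perm_inj _ s)).
  by apply: eq_bigr => k _; rewrite lift_perm_id lift_perm_lift.
apply: eq_bigr => i _; rewrite big_ord_recl add0n.
apply: eq_bigr => k _; rewrite !lift_perm_lift !lift0 ltnS.
by congr (nat_of_bool (_ && _)); rewrite /= /bump; lia.
Qed.

Lemma lift_perm_bij n :
  bijective (fun js : 'I_n.+1 * 'S_n => lift_perm ord0 js.1 js.2).
Proof.
apply: inj_card_bij => [[j s] [j' s'] /= eq_js|].
  have ej : j = j' by rewrite -(lift_perm_id ord0 j s) eq_js lift_perm_id.
  congr (_, _); first exact: ej.
  apply/permP => k; apply: (@lift_inj _ j).
  by rewrite -(lift_perm_lift ord0 j) eq_js -ej lift_perm_lift.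
by rewrite card_prod !card_Sn card_ord factS.
Qed.

Lemma sum_inversions n : \sum_(pi : 'S_n) q ^+ inversions pi = qfact R q n.
Proof.
elim: n => [|n IHn].
  rewrite /qfact big_ord0 (big_pred1 1%g) => [|s]; last first.
    by apply/esym/eqP/permP => -[].
  by rewrite !inversionsE big_ord0.
rewrite (reindex _ (onW_bij _ (lift_perm_bij n))) /=.
rewrite -(pair_bigA _ (fun j s => q ^+ inversions (lift_perm ord0 j s))) /=.
rewrite qfactS mulrC /qint mulr_suml; apply: eq_bigr => j _.
rewrite -IHn mulr_sumr; apply: eq_bigr => s _.
by rewrite inversions_lift_perm exprD.
Qed.

(** The witness sends x to the number of y with f y < f x. *)
Lemma rank_perm n (f : 'I_n -> nat) : injective f ->
  exists rho : 'S_n, forall x y, (rho x < rho y)%N = (f x < f y)%N.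
Proof.
move=> f_inj; pose B x := [set y | (f y < f x)%N].
have ltB x y : (f x < f y)%N -> (#|B x| < #|B y|)%N.
  move=> ltxy; apply/proper_card/properP; split.
    by apply/subsetP => z; rewrite !inE => /ltn_trans; apply.
  by exists x; rewrite !inE ?ltnn.
have ltBn x : (#|B x| < n)%N.
  rewrite -[X in (_ < X)%N]card_ord -cardsT; apply/proper_card/properP.
  by split; [apply/subsetP => z | exists x; rewrite !inE ?ltnn].
pose rank x := Ordinal (ltBn x).
have rankE x y : (rank x < rank y)%N = (f x < f y)%N.
  case: (ltngtP (f x) (f y)) => [/ltB //|/ltB /ltnW|/f_inj ->].
    by rewrite leqNgt => /negbTE.
  by rewrite ltnn.
have rank_inj : injective rank.
  move=> x y eq_rank; apply: f_inj.
  by case: (ltngtP (f x) (f y)) => //; rewrite -rankE eq_rank ltnn.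
by exists (perm rank_inj) => x y; rewrite !permE rankE.
Qed.

(* Relabelling the letters by rank turns f-inversions into ordinary ones. *)
Lemma sum_key_inversions n (f : 'I_n -> nat) : injective f ->
  \sum_(s : 'S_n) q ^+ (\sum_(i < n) \sum_(j < n)
      ((i < j) && (f (s j) < f (s i))))%N = qfact R q n.
Proof.
move=> /rank_perm[rho rhoE]; rewrite -sum_inversions.
rewrite [RHS](reindex_inj (mulIg rho)); apply: eq_bigr => s _.
rewrite !inversionsE; congr (_ ^+ _).
by apply: eq_bigr => i _; apply: eq_bigr => j _; rewrite !permM rhoE.
Qed.

(** * Inversions of colored permutations *)

Section Colors.
Variables (n k : nat).

(** Here [c] colors letters, not positions; since x < n, the key encodes the lexicographic order by
    color, then letter. *)
Definition color_key (c : {ffun 'I_n -> 'I_k}) (x : 'I_n) : nat := c x * n + x.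

Lemma ltn_color_key c x y : (color_key c x < color_key c y)%N =
  (c x < c y)%N || (c x == c y) && (x < y)%N.
Proof.
have lt x' y' : (c x' < c y')%N -> (color_key c x' < color_key c y')%N.
  move=> ltc; rewrite /color_key.
  have : (c x' * n + n <= c y' * n)%N by rewrite addnC -mulSn leq_mul2r ltc orbT.
  by have := ltn_ord x'; lia.
rewrite -[c x == c y]/(c x == c y :> nat).
case: (ltngtP (c x) (c y)) => [/lt //|/lt|eqc].
  by move=> /ltnW; rewrite leqNgt => /negbTE.
by rewrite /color_key eqc ltn_add2l.
Qed.

Lemma color_key_inj c : injective (color_key c).
Proof.
move=> x y eqk; case: (ltngtP (c x) (c y)) => [ltc|ltc|eqc].
- by have := ltn_color_key c x y; rewrite eqk ltnn ltc.
- by have := ltn_color_key c y x; rewrite eqk ltnn ltc.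
by apply/val_inj/eqP; move/eqP: eqk; rewrite /color_key eqc eqn_add2l.
Qed.

(** The appended letter is larger than all others and has color 0, so position i is inverted with it
    exactly when its color is nonzero. *)
Lemma colored_inversionsE (P : colored_perm n k) :
  colored_inversions P =
  ((\sum_(i < n) \sum_(j < n)
      ((i < j) && ((P.2 j < P.2 i) || (P.2 i == P.2 j) && (P.1 j < P.1 i))))
   + \sum_(i < n) (0 < P.2 i))%N.
Proof.
have wE (i : 'I_n) : widen_ord (leqnSn n) i = lift ord_max i.
  by apply/val_inj/esym/lift_max.
rewrite /colored_inversions (@card_increasing_pairs _ (colored_gt P)).
rewrite big_ord_recr /=.
rewrite [X in (_ + X)%N]big1 ?addn0 => [|j _]; last first.
  by rewrite ltnNge leq_ord.
rewrite -big_split; apply: eq_bigr => i _; rewrite big_ord_recr /=.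
congr (_ + _)%N.
  apply: eq_bigr => j _.
  by rewrite !wE /colored_gt /ext_color /ext_letter !liftK.
rewrite ltn_ord wE /colored_gt /ext_color /ext_letter !liftK unlift_none /=.
by rewrite [(n < _)%N]ltnNge (ltnW (ltn_ord (P.1 i))) andbF orbF.
Qed.

Lemma sum_color_weights : (0 < k)%N ->
  \sum_(x < k) q ^+ (0 < x)%N = (k%:R - 1) * q + 1.
Proof.
case: k => // m _; rewrite big_ord_recl /= sumr_const card_ord.
by rewrite -natr1 addrK mulr_natl addrC.
Qed.

Lemma sum_colored_inversions : (0 < k)%N ->
  \sum_(P : colored_perm n k) q ^+ colored_inversions P
  = qfact R q n * ((k%:R - 1) * q + 1) ^+ n.
Proof.
move=> k_gt0.
rewrite -(pair_bigA _ (fun s c => q ^+ colored_inversions (s, c))) /=.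
pose paint (s : 'S_n) (c : {ffun 'I_n -> 'I_k}) := [ffun i => c (s i)].
have paint_bij s : bijective (paint s).
  exists (paint s^-1)%g => c; apply/ffunP => i.
    by rewrite !ffunE permKV.
  by rewrite !ffunE permK.
(* With the letter coloring [c] fixed, the exponent counts inversions for an injective key, and the
   last-position weight does not depend on [s]. *)
transitivity (\sum_(c : {ffun 'I_n -> 'I_k}) \sum_(s : 'S_n)
    q ^+ (\sum_(i < n) \sum_(j < n)
      ((i < j) && (color_key c (s j) < color_key c (s i))))%N
    * \prod_(x < n) q ^+ (0 < c x)%N).
  rewrite [RHS]exchange_big; apply: eq_bigr => s _.
  rewrite (reindex _ (onW_bij _ (paint_bij s))); apply: eq_bigr => c _.
  rewrite colored_inversionsE exprD /=; congr (_ * _).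
    congr (_ ^+ _); apply: eq_bigr => i _; apply: eq_bigr => j _.
    by rewrite ltn_color_key !ffunE eq_sym.
  rewrite expr_sum [RHS](reindex_inj (@perm_inj _ s)).
  by apply: eq_bigr => i _; rewrite ffunE.
under eq_bigr => c _.
  rewrite -mulr_suml (@sum_key_inversions n _ (color_key_inj c)); over.
rewrite -mulr_sumr; congr (_ * _).
(* Each letter chooses its color independently. *)
rewrite -(bigA_distr_bigA (fun (_ : 'I_n) (x : 'I_k) => q ^+ (0 < x)%N)) /=.
by rewrite sum_color_weights // prodr_const card_ord.
Qed.

End Colors.
End Permutations.

Theorem corollary8 (R : comNzRingType) (q : R) :
  let C := cfC {| par_a := q; par_c := q; par_h := q; par_r := q;
                  par_b := q ^+ 2; par_f := q ^+ 2; par_d := q ^+ 2;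
                  par_l := q ^+ 2; par_t := q ^+ 2;
                  par_g := 0; par_w := 0;
                  par_p := 1; par_u := 1;
                  par_s := 2%:R * q |} in
  (C =1 fun n : nat => \sum_(pi : 'S_n) q ^+ inversions pi)
  /\ forall k : nat, (1 < k)%N ->
       fps_subst_scale ((k%:R - 1) * q + 1) C
       =1 fun n : nat => \sum_(P : colored_perm n k) q ^+ colored_inversions P.
Proof.
move=> C.
have CE n : C n = qfact R q n.
  rewrite /C /cfC (@jfrac_stieltjes R _ _ (laguerre_coef R q)).
  - by rewrite /laguerre_coef qbin0 expr1n mul1r subn0.
  - case=> [|k]; last by rewrite /laguerre_coef expr0n mul0r.
    by rewrite /laguerre_coef /qfact big_ord0 expr1n mulr1.
  move=> n' k; rewrite laguerre_coef_rec; congr (_ + _ * _ + _ * _).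
    (* Since w = 0, the term u w^k survives only at k = 0, where 0^0 = 1 gives alpha_0 = 1; for k >
       0, 2 q^k [k]_q + q^(2k) = q^k ([k]_q + [k+1]_q). *)
    rewrite /cf_alpha /= xynum_qint; case: k => [|k].
      rewrite [xynum 0 _ _]/xynum big_ord0 qintS qint0; ring.
    rewrite xynum_x0 (qintSr _ _ k.+1) /= -exprM !exprS mul2n -addnn exprD.
    by ring.
  rewrite /cf_beta /= xynum_qint -muln2 exprS exprM; ring.
split=> [n|k k_gt1 n]; first by rewrite CE sum_inversions.
by rewrite /fps_subst_scale CE sum_colored_inversions // ltnW.
Qed.
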